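(* Let $$A(t_1,t_2,t_3,t_4,r,s,x,v,w;z):=\sum_{n\ge 1}\sum_{W\in\mathfrak L_n}t_1^{\mathrm{sdeb}(W)}t_2^{\mathrm{sdea}(W)}t_3^{\mathrm{neb}(W)}t_4^{\mathrm{nea}(W)}r^{\mathrm{nde}(W)}s^{\mathrm{asc}(W)}x^{\mathrm{cs}(W)}v^{\mathrm{ht}(W)}w^{\mathrm{wt}(W)}z^n .$$ Then $$A(t_1,t_2,t_3,t_4,r,s,x,v,w;z)=\frac{x}{rs}\,A\Big(t_4,\frac{t_3}{vw},vwt_2,t_1,\frac1r,\frac1s,\frac1x,v,w;\,rsxz\Big)$$ as formal power series in $z$ whose coefficients are Laurent polynomials in the other variables.
   Context: $[n]=\{1,\dots,n\}$. A 2-Motzkin path of length $n$ is a word $w=w_1\cdots w_n$ over the alphabet $\{\mathrm N,\mathrm S,\mathrm E,\mathrm{dE}\}$ such that, with $h_i:=\#\{j<i: w_j=\mathrm N\}-\#\{j<i: w_j=\mathrm S\}$ for $1\le i\le n+1$, one has $h_i\ge 0$ for all $i$ and $h_{n+1}=0$. An sr-Laguerre history of length $n$ is a triple $W=(w,h,c)$ where $w$ is a 2-Motzkin path of length $n$, $h=h_1\cdots h_n$ is its height sequence, and $c=c_1\cdots c_n$ is a sequence of integers with $0\le c_i\le h_i$ if $w_i\in\{\mathrm N,\mathrm E\}$ and $1\le c_i\le h_i$ if $w_i\in\{\mathrm S,\mathrm{dE}\}$. $\mathfrak L_n$ is the set of all of these. Put $\mathrm{cs}(W):=\max\{i\in[n]: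 c_i=0\}$. With $m=\mathrm{cs}(W)$, the statistics are: $\mathrm{neb}(W)=\#\{i<m: w_i\in\{\mathrm N,\mathrm E\}\}$, $\mathrm{nea}(W)=\#\{i>m: w_i\in\{\mathrm N,\mathrm E\}\}$, $\mathrm{sdeb}(W)=\#\{i<m: w_i\in\{\mathrm S,\mathrm{dE}\}\}$, $\mathrm{sdea}(W)=\#\{i>m: w_i\in\{\mathrm S,\mathrm{dE}\}\}$, $\mathrm{nde}(W)=\#\{i\in[n-1]: w_i\in\{\mathrm N,\mathrm{dE}\}\}$, $\mathrm{ht}(W)=\sum_{i=1}^n h_i$, $\mathrm{wt}(W)=\sum_{i=1}^n c_i$, and $\mathrm{asc}(W)$ is the number of $i\in[n-1]$ such that either $w_i\in\{\mathrm N,\mathrm E\}$ and $c_i<c_{i+1}$, or $w_i\in\{\mathrm S,\mathrm{dE}\}$ and $c_i\le c_{i+1}$. (The variable $w$ in $A$ is unrelated to the path $w$.) *)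

(* Defs.v *)
From HB Require Import structures.
From mathcomp Require Import all_boot all_order all_algebra.
From mathcomp Require Import finmap boolp.
From mathcomp Require Import monalg.

Set Implicit Arguments.
Unset Strict Implicit.
Unset Printing Implicit Defensive.

Import GRing.Theory.

Local Open Scope ring_scope.

(* Laurent polynomials in n commuting variables over R, i.e. the group ring
   R[Z^n]: finitely supported functions Z^n -> R with the convolution product.
   The algebra structure on {malg R[K]} provided by monalg does not apply, since
   it requires that the monoid K have no nontrivial invertible element. *)
Definition laurent (R : comNzRingType) (n : nat) : Type := {malg R['rV[int]_n]}.

HB.instance Definition _ (R : comNzRingType) (n : nat) :=
  GRing.Zmodule.copy (laurent R n) {malg R['rV[int]_n]}.

Section LaurentRing.
Variables (R : comNzRingType) (n : nat).
Implicit Types (p q : laurent R n) (k l : 'rV[int]_n).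

Definition lmul p q : laurent R n :=
  \sum_(k <- msupp p) \sum_(l <- msupp q) << p@_k * q@_l *g k + l >>.

Definition lone : laurent R n := << 0 >>.

Lemma lmulw (d1 d2 : {fset 'rV[int]_n}) p q :
  (msupp p `<=` d1)%fset -> (msupp q `<=` d2)%fset ->
  lmul p q = \sum_(k <- d1) \sum_(l <- d2) << p@_k * q@_l *g k + l >>.
Proof.
move=> le_d1 le_d2; rewrite /lmul (big_fset_incl _ le_d1) /=.
  apply/eq_bigr=> k1 _; apply/big_fset_incl => // k _ /mcoeff_outdom ->.
  by rewrite mulr0 monalgU0.
move=> k _ /mcoeff_outdom g1k.
by rewrite big1 => // k' _; rewrite g1k mul0r monalgU0.
Qed.

Lemma lmulUU (a b : R) k l :
  lmul << a *g k >> << b *g l >> = << a * b *g k + l >>.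
Proof. by rewrite (lmulw msuppU_le msuppU_le) !big_seq_fset1 !mcoeffUU. Qed.

Lemma lmulC : commutative lmul.
Proof.
move=> p q; rewrite /lmul exchange_big /=.
by apply/eq_bigr=> k _; apply/eq_bigr=> l _; rewrite mulrC addrC.
Qed.

Lemma lmulDl : left_distributive lmul +%R.
Proof.
move=> p1 p2 q; set d := (msupp p1 `|` msupp p2)%fset.
rewrite (@lmulw d (msupp q) p1) ?fsubsetUl //.
rewrite (@lmulw d (msupp q) p2) ?fsubsetUr //.
rewrite (@lmulw d (msupp q) (p1 + p2)) ?msuppD_le //.
rewrite -big_split /=; apply/eq_bigr=> k _.
rewrite -big_split /=; apply/eq_bigr=> l _.
by rewrite mcoeffD mulrDl monalgUD.
Qed.

Lemma lmul0 : left_zero 0 lmul.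
Proof. by move=> p; rewrite /lmul msupp0 big_seq_fset0. Qed.

Lemma lmulDr : right_distributive lmul +%R.
Proof. by move=> p q1 q2; rewrite lmulC lmulDl !(lmulC p). Qed.

Lemma lmul0r : right_zero 0 lmul.
Proof. by move=> p; rewrite lmulC lmul0. Qed.

Lemma lmul_suml (I : Type) (s : seq I) (F : I -> laurent R n) q :
  lmul (\sum_(i <- s) F i) q = \sum_(i <- s) lmul (F i) q.
Proof.
exact: (big_morph (lmul^~ q) (fun _ _ => lmulDl _ _ _) (lmul0 _)).
Qed.

Lemma lmul_sumr (I : Type) (s : seq I) (F : I -> laurent R n) p :
  lmul p (\sum_(i <- s) F i) = \sum_(i <- s) lmul p (F i).
Proof.
exact: (big_morph (lmul p) (fun _ _ => lmulDr _ _ _) (lmul0r _)).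
Qed.

Lemma lmulA : associative lmul.
Proof.
move=> p q r; rewrite [p]monalgE.
rewrite (lmul_suml _ _ (lmul q r)) (lmul_suml _ _ q) (lmul_suml _ _ r).
apply/eq_bigr=> k _; rewrite [q]monalgE.
rewrite (lmul_suml _ _ r) !(lmul_sumr _ _ << _ *g k >>) (lmul_suml _ _ r).
apply/eq_bigr=> l _; rewrite [r]monalgE.
rewrite (lmul_sumr _ _ << _ *g l >>) (lmul_sumr _ _ << _ *g k >>).
rewrite (lmul_sumr _ _ (lmul _ _)); apply/eq_bigr=> m _.
by rewrite !lmulUU mulrA addrA.
Qed.

Lemma lmul1 : left_id lone lmul.
Proof.
move=> p; rewrite [p]monalgE lmul_sumr; apply/eq_bigr=> k _.
by rewrite lmulUU mul1r add0r.
Qed.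

Lemma lone_neq0 : lone != 0.
Proof. by rewrite monalgU_eq0 oner_eq0. Qed.

HB.instance Definition _ := GRing.Zmodule_isComNzRing.Build (laurent R n)
  lmulA lmulC lmul1 lmulDl lone_neq0.

Definition lunit (p : laurent R n) : bool := `[< exists q, q * p == 1 >].

Definition linv (p : laurent R n) : laurent R n :=
  if pselect (exists q, q * p == 1) is left e then xchoose e else p.

Lemma lmulV : {in lunit, left_inverse 1 linv *%R}.
Proof.
move=> p /asboolP p_unit; rewrite /linv; case: pselect => // e.
exact/eqP/(xchooseP e).
Qed.

Lemma lunitP p q : q * p = 1 -> lunit p.
Proof. by move=> qp1; apply/asboolP; exists q; apply/eqP. Qed.

Lemma linv_out : {in [predC lunit], linv =1 id}.
Proof.
move=> p; rewrite !inE => pNunit; rewrite /linv; case: pselect => // e.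
by case/negP: pNunit; apply/asboolP.
Qed.

HB.instance Definition _ := GRing.ComNzRing_hasMulInverse.Build (laurent R n)
  lmulV lunitP linv_out.

Definition lvar (i : 'I_n) : laurent R n := << delta_mx 0 i >>.

Lemma lvar_unit (i : 'I_n) : lvar i \is a GRing.unit.
Proof.
apply: (@lunitP _ (<< - delta_mx 0 i >> : laurent R n)).
by rewrite [LHS]lmulUU mul1r addNr.
Qed.

End LaurentRing.

(* A formal power series f in z over K is its sequence of coefficients
   n |-> [z^n] f; fps_dilate a f is f(a z). *)
Definition fps (K : Type) : Type := nat -> K.

Definition fps_scale (K : comUnitRingType) (a : K) (f : fps K) : fps K :=
  fun n => a * f n.

Definition fps_dilate (K : comUnitRingType) (a : K) (f : fps K) : fps K :=
  fun n => a ^+ n * f n.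

Variant step : Type := stepN | stepS | stepE | stepdE.

Definition step_code (a : step) : 'I_4 :=
  match a with stepN => 0 | stepS => 1 | stepE => 2 | stepdE => 3 end.

Definition step_decode (k : 'I_4) : step :=
  nth stepN [:: stepN; stepS; stepE; stepdE] k.

Lemma step_codeK : cancel step_code step_decode.
Proof. by case. Qed.

HB.instance Definition _ := Finite.copy step (can_type step_codeK).

(* The candidate pairs (w, c) of step words and weight words. The sequence h is
   determined by w, hence not stored. Bounding the weights by n makes the type
   finite and excludes no history, as c_i <= h_i <= i - 1 < n. *)
Definition prehistory (n : nat) : finType :=
  (n.-tuple step * n.-tuple 'I_n.+1)%type.

Section Statistics.
Local Open Scope nat_scope.
Variables (n : nat) (W : prehistory n).

(* Positions are counted from 1; index_iota a b is [a; ...; b - 1]. The values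
   at positions outside 1..n are junk and never used. *)
Definition wstep (i : nat) : step := nth stepN W.1 i.-1.

Definition wwt (i : nat) : nat := nth ord0 W.2 i.-1.

Definition isNE (a : step) : bool := (a == stepN) || (a == stepE).

Definition isSdE (a : step) : bool := (a == stepS) || (a == stepdE).

Definition height (i : nat) : int :=
  ((count (fun j => wstep j == stepN) (index_iota 1 i))%:Z
   - (count (fun j => wstep j == stepS) (index_iota 1 i))%:Z)%R.

Definition two_motzkin : bool :=
  all (fun i => (0 <= height i)%R) (index_iota 1 n.+2) && (height n.+1 == 0%R).

Definition sr_laguerre : bool :=
  two_motzkin &&
  all (fun i => if isNE (wstep i) then ((wwt i)%:Z <= height i)%R
                else (1 <= wwt i) && ((wwt i)%:Z <= height i)%R)
      (index_iota 1 n.+1).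

(* For n >= 1 the maximum is over a nonempty set, as c_1 = 0. *)
Definition cs : nat := \max_(1 <= i < n.+1 | wwt i == 0) i.

Definition neb : nat := count (fun i => isNE (wstep i)) (index_iota 1 cs).

Definition nea : nat := count (fun i => isNE (wstep i)) (index_iota cs.+1 n.+1).

Definition sdeb : nat := count (fun i => isSdE (wstep i)) (index_iota 1 cs).

Definition sdea : nat :=
  count (fun i => isSdE (wstep i)) (index_iota cs.+1 n.+1).

Definition nde : nat :=
  count (fun i => (wstep i == stepN) || (wstep i == stepdE)) (index_iota 1 n).

(* The heights of a 2-Motzkin path are nonnegative, so `|h_i| = h_i. *)
Definition ht : nat := \sum_(1 <= i < n.+1) `|height i|%N.

Definition wt : nat := \sum_(1 <= i < n.+1) wwt i.

Definition asc : nat :=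
  count (fun i => (isNE (wstep i) && (wwt i < wwt i.+1))
                  || (isSdE (wstep i) && (wwt i <= wwt i.+1)))
        (index_iota 1 n).

End Statistics.

(* A(t1,t2,t3,t4,r,s,x,v,w; z), with arbitrary values in place of the
   variables other than z. *)
Definition srL_gf (K : comUnitRingType) (t1 t2 t3 t4 r s x v w : K) : fps K :=
  fun n => if n == 0%N then 0 else
    \sum_(W : prehistory n | sr_laguerre W)
      t1 ^+ sdeb W * t2 ^+ sdea W * t3 ^+ neb W * t4 ^+ nea W
      * r ^+ nde W * s ^+ asc W * x ^+ cs W * v ^+ ht W * w ^+ wt W.

(* Main.v *)
(* A step is a pair of bits: a_i = 1 iff w_i is N or E, and b_i = 1 iff w_i is N
   or dE, so that h_{i+1} = h_i + a_i + b_i - 1, and i is an ascent iff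
   c_i + a_i <= c_{i+1}. With m = cs(W) and k = n + 1 - j, define an involution
   W |-> W' on sr-Laguerre histories of length n >= 1 by
     a'_j = 1 - a_k for k <> m, and a'_j = 1 for k = m;
     b'_j = 1 - b_{n-j} for j < n, and b'_n = 0 (b_n = 0 in every history);
     c'_j = c_k + a_k, 0, c_k + a_k - 1 for k < m, k = m, k > m respectively.
   Then h'_j = h_k + a_k - 1 + [k < m], from which W' is a history with
   cs(W') = n + 1 - m. The exchange k <-> j swaps neb with sdea and nea with
   sdeb, complements nde and asc to n - 1, and changes both ht and wt by
   neb(W) - sdea(W); the identity follows term by term. *)
Require Import Defs.
From mathcomp Require Import all_boot all_order all_algebra.
From mathcomp Require Import zify ring.

Set Implicit Arguments.
Unset Strict Implicit.
Unset Printing Implicit Defensive.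

Import Order.TTheory GRing.Theory Num.Theory.

Local Open Scope ring_scope.

(** * Steps as pairs of bits *)

Definition isNdE (a : step) : bool := (a == stepN) || (a == stepdE).

Definition mkstep (a b : bool) : step :=
  if a then if b then stepN else stepE else if b then stepdE else stepS.

Lemma isNE_mkstep a b : isNE (mkstep a b) = a.
Proof. by case: a b => [] []. Qed.

Lemma isNdE_mkstep a b : isNdE (mkstep a b) = b.
Proof. by case: a b => [] []. Qed.

Lemma mkstepK a : mkstep (isNE a) (isNdE a) = a.
Proof. by case: a. Qed.

Lemma isSdEN a : isSdE a = ~~ isNE a.
Proof. by case: a. Qed.

(** * Counts as sums over all positions, ready for reversal and termwise comparison *)

Lemma count_lt_sum (P : pred nat) (m n : nat) : (m <= n.+1)%N ->
  count P (index_iota 1 m) = (\sum_(1 <= i < n.+1) ((i < m) && P i))%N.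
Proof.
move=> le_mn; rewrite -sum1_count (big_nat_widen _ _ n.+1) // big_mkcond.
by apply: eq_bigr => i _; rewrite andbC; case: andb.
Qed.

Lemma count_gt_sum (P : pred nat) (m n : nat) :
  count P (index_iota m.+1 n.+1) = (\sum_(1 <= i < n.+1) ((m < i) && P i))%N.
Proof.
rewrite -sum1_count (big_nat_widenl _ 1) // big_mkcond.
by apply: eq_bigr => i _; rewrite andbC; case: andb.
Qed.

Lemma big_nat_flip (F : nat -> nat) (n : nat) :
  (\sum_(1 <= i < n.+1) F i = \sum_(1 <= i < n.+1) F (n.+1 - i))%N.
Proof. by rewrite big_nat_rev; apply: eq_big_nat => i _; congr F; lia. Qed.

(** Reversing the second count pairs i with n - i, and each of the n - 1 pairs contributes exactly
    1. Serves [nde] and [asc]. *)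
Lemma count_reflect (P Q : pred nat) (n : nat) :
  (forall i, (1 <= i < n)%N -> P i = ~~ Q (n - i)%N) ->
  (count P (index_iota 1 n) + count Q (index_iota 1 n) = n.-1)%N.
Proof.
move=> PQ; rewrite -!sum1_count [X in (X + _)%N]big_mkcond /=.
rewrite [X in (_ + X)%N]big_mkcond [X in (_ + X)%N]big_nat_rev /= -big_split /=.
rewrite (@eq_big_nat _ _ _ _ _ _ (fun=> 1%N)) => [|i lt_i].
  by rewrite sum_nat_const_nat; lia.
by rewrite PQ // (_ : 1 + n - i.+1 = n - i)%N; [case: (Q _) | lia].
Qed.

(** * Heights, weights and the last zero weight of a history *)

Section History.
Variables (n : nat) (W : prehistory n).
Implicit Types (i : nat).

Lemma height1 : height W 1 = 0.
Proof. by []. Qed.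

Lemma heightS i : (0 < i)%N ->
  height W i.+1 = height W i + (isNE (wstep W i))%:Z + (isNdE (wstep W i))%:Z - 1.
Proof.
move=> i_gt0; have countS (P : pred nat) :
    count P (index_iota 1 i.+1) = (count P (index_iota 1 i) + P i)%N.
  rewrite /index_iota subSn // -[(i - 1).+1%N]addn1 iotaD count_cat /=.
  by rewrite subnKC // addn0.
by rewrite /height !countS; case: (wstep W i) => /=; lia.
Qed.

(** A step raises the height by at most 1. This bound keeps flipped weights within ['I_n.+1]. *)
Lemma height_le i : (0 < i)%N -> height W i <= i.-1%:Z.
Proof.
case: i => // i _ /=; elim: i => [|i IHi]; first by [].
rewrite heightS //; case: (isNE _); case: (isNdE _) => /=; lia.
Qed.

Lemma ascE i :
  (isNE (wstep W i) && (wwt W i < wwt W i.+1) ||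
   isSdE (wstep W i) && (wwt W i <= wwt W i.+1))%N =
  (wwt W i + isNE (wstep W i) <= wwt W i.+1)%N.
Proof. by rewrite isSdEN; case: isNE => /=; rewrite ?orbF ?addn0 ?addn1. Qed.

(** The conditions 0 <= c_i <= h_i already make the heights nonnegative, so only the final height is
    kept from [two_motzkin]. *)
Lemma sr_laguerreP :
  reflect (height W n.+1 = 0 /\
           forall i, (1 <= i <= n)%N ->
             (wwt W i)%:Z <= height W i /\
             (~~ isNE (wstep W i) -> (0 < wwt W i)%N))
          (sr_laguerre W).
Proof.
apply: (iffP idP) => [/andP[/andP[_ /eqP h_end] /allP cle]|[h_end cle]].
  split=> // i lt_in; have := cle i; rewrite mem_index_iota => /(_ lt_in).
  by case: (isNE _) => [-> |/andP[-> ->]].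
apply/andP; split; last first.
  apply/allP => i; rewrite mem_index_iota => /cle[le_ch].
  by rewrite le_ch andbT; case: (isNE _) => // /(_ isT).
rewrite /two_motzkin h_end eqxx andbT; apply/allP => i.
rewrite mem_index_iota; case: (eqVneq i n.+1) => [-> _|ne_i lt_i].
  by rewrite h_end.
by have [] := cle i; lia.
Qed.

Lemma csE m : (1 <= m <= n)%N -> wwt W m = 0%N ->
  (forall i, (m < i <= n)%N -> (0 < wwt W i)%N) -> cs W = m.
Proof.
move=> le_m c_m c_gt; apply/eqP; rewrite eqn_leq; apply/andP; split.
  rewrite /cs big_nat_cond; apply/bigmax_leqP_seq => i _ /andP[le_i /eqP c_i].
  by rewrite leqNgt; apply/negP => lt_mi; have := c_gt i; rewrite c_i; lia.
rewrite /cs.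
by apply: (@leq_bigmax_seq _ _ _ (fun i => i)); rewrite ?mem_index_iota ?c_m.
Qed.

Hypotheses (n_gt0 : (0 < n)%N) (lagW : sr_laguerre W).

Lemma cs_spec :
  [/\ (1 <= cs W <= n)%N, wwt W (cs W) = 0%N &
      forall i, (cs W < i <= n)%N -> (0 < wwt W i)%N].
Proof.
have [_ cle] := sr_laguerreP lagW.
have c1 : wwt W 1 = 0%N by have [] := cle 1%N n_gt0; rewrite height1; lia.
pose P m := (1 <= m <= n)%N && (wwt W m == 0%N).
have exP : exists m, P m by exists 1%N; rewrite /P n_gt0 c1.
have ubP m : P m -> (m <= n)%N by case/andP => /andP[].
case: (ex_maxnP exP ubP) => m /andP[le_m /eqP c_m] max_m.
suff -> : cs W = m.
  split=> // i lt_mi; rewrite lt0n; apply/negP => c_i.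
  by have := max_m i; rewrite /P c_i; lia.
apply: csE => // i lt_mi; rewrite lt0n; apply/negP => c_i.
by have := max_m i; rewrite /P c_i; lia.
Qed.

Lemma isNE_cs : isNE (wstep W (cs W)).
Proof.
have [le_m c_m _] := cs_spec; have [_ /(_ _ le_m)[_]] := sr_laguerreP lagW.
by rewrite c_m; case: (isNE _) => // /(_ isT).
Qed.

(** If b_n = 1, then h_{n+1} = 0 forces h_n = a_n = 0; the last step is then dE and would need 1 <=
    c_n <= h_n. *)
Lemma isNdE_last : isNdE (wstep W n) = false.
Proof.
have [h_end cle] := sr_laguerreP lagW; have [] := cle n; first lia.
by move: h_end; rewrite heightS //; case: (isNE _); case: (isNdE _) => /=; lia.
Qed.

Lemma nebE : neb W = (\sum_(1 <= i < n.+1) ((i < cs W) && isNE (wstep W i)))%N.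
Proof. by rewrite /neb (@count_lt_sum _ _ n) //; have [] := cs_spec; lia. Qed.

Lemma sdebE : sdeb W = (\sum_(1 <= i < n.+1) ((i < cs W) && isSdE (wstep W i)))%N.
Proof. by rewrite /sdeb (@count_lt_sum _ _ n) //; have [] := cs_spec; lia. Qed.

Lemma neaE : nea W = (\sum_(1 <= i < n.+1) ((cs W < i) && isNE (wstep W i)))%N.
Proof. by exact: count_gt_sum. Qed.

Lemma sdeaE : sdea W = (\sum_(1 <= i < n.+1) ((cs W < i) && isSdE (wstep W i)))%N.
Proof. by exact: count_gt_sum. Qed.

End History.

Arguments sr_laguerreP {n W}.

(** * The involution *)

Section Flip.
Variable n : nat.
Implicit Types (W : prehistory n) (i : nat).

Definition flipNE W i : bool :=
  (n.+1 - i == cs W)%N || ~~ isNE (wstep W (n.+1 - i)).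

Definition flipNdE W i : bool := (i < n)%N && ~~ isNdE (wstep W (n - i)).

(** On histories the truncated subtraction is exact, since c_k > 0 for k > m. *)
Definition flipwt W i : nat :=
  let k := (n.+1 - i)%N in
  if k == cs W then 0%N else
  (wwt W k + isNE (wstep W k) - (cs W < k)%N)%N.

(** [inord] makes [flip] total on prehistories; on histories the weights are at most n, so it alters
    nothing ([wwt_flip]). *)
Definition flip W : prehistory n :=
  ([tuple mkstep (flipNE W i.+1) (flipNdE W i.+1) | i < n],
   [tuple inord (flipwt W i.+1) | i < n]).

Lemma wstep_flip W i : (1 <= i <= n)%N ->
  wstep (flip W) i = mkstep (flipNE W i) (flipNdE W i).
Proof.
case: i => // i lt_in.
by rewrite -[LHS](tnth_nth stepN (flip W).1 (Ordinal lt_in)) [LHS]tnth_mktuple.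
Qed.

Lemma wwt_flip_inord W i : (1 <= i <= n)%N ->
  wwt (flip W) i = (inord (flipwt W i) : 'I_n.+1).
Proof.
case: i => // i lt_in.
congr val; rewrite -[LHS](tnth_nth ord0 (flip W).2 (Ordinal lt_in)).
exact: tnth_mktuple.
Qed.

Lemma prehistory_eq W1 W2 :
  (forall i, (1 <= i <= n)%N -> wstep W1 i = wstep W2 i /\ wwt W1 i = wwt W2 i) ->
  W1 = W2.
Proof.
case: W1 W2 => [w1 c1] [w2 c2] eqW; congr (_, _); apply: eq_from_tnth => i.
  by rewrite !(tnth_nth stepN); have [] := eqW i.+1 (ltn_ord i).
by apply: val_inj; rewrite !(tnth_nth ord0); have [] := eqW i.+1 (ltn_ord i).
Qed.

(** * Validity and statistics of the flipped history *)

Section Statistics.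
Variable W : prehistory n.
Hypotheses (n_gt0 : (0 < n)%N) (lagW : sr_laguerre W).

Let csP := cs_spec n_gt0 lagW.

(** Induction on i, hence downwards in k. The base case k = n is h_n + a_n - 1 = 0, from h_{n+1} = 0
    and b_n = 0. *)
Lemma height_flip i : (1 <= i <= n)%N ->
  height (flip W) i = height W (n.+1 - i)%N
    + (isNE (wstep W (n.+1 - i)%N))%:Z - 1 + (n.+1 - i < cs W)%:Z.
Proof.
have [le_m _ _] := csP; have [h_end _] := sr_laguerreP lagW.
case: i => // i; elim: i => [|i IHi] lt_in.
  rewrite height1 subn1 /=; move: h_end.
  rewrite heightS // (isNdE_last n_gt0 lagW).
  have -> : (n < cs W)%N = false by lia.
  by lia.
rewrite heightS // IHi ?wstep_flip; try lia.
rewrite isNE_mkstep isNdE_mkstep /flipNE /flipNdE.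
have -> : (i.+1 < n)%N by lia.
have -> : (n.+1 - i.+1 = (n.+1 - i.+2).+1)%N by lia.
have -> : (n - i.+1 = n.+1 - i.+2)%N by lia.
rewrite heightS; last by lia.
(* At k + 1 = m the new bit is 1 although a_m = 1; this excess over 1 - a_m switches on the term
   [k < m]. *)
set k := (n.+1 - i.+2)%N; case: (eqVneq k.+1 (cs W)) => [eq_m|ne_m] /=.
  by rewrite eq_m isNE_cs // ltnn leqnn; case: (isNE _); case: (isNdE _) => /=; lia.
have -> : (k.+1 < cs W)%N = (k < cs W)%N by lia.
by case: (k < cs W)%N; do 2!case: (isNE _); case: (isNdE _) => /=; lia.
Qed.

Lemma height_flip_end : height (flip W) n.+1 = 0.
Proof.
have [h_end cle] := sr_laguerreP lagW; have [le_m c_m _] := csP.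
rewrite heightS // height_flip ?wstep_flip ?n_gt0 ?leqnn //.
rewrite isNE_mkstep isNdE_mkstep /flipNE /flipNdE ltnn /= subSnn height1.
case: (eqVneq 1%N (cs W)) => [eq_m|ne_m] /=.
  by rewrite -eq_m ltnn [in wstep W 1]eq_m isNE_cs.
have -> : (1 < cs W)%N by lia.
by case: (isNE _).
Qed.

(** For k <> m weight and height change by the same amount; for k = m the bound becomes 0 <= h_m. A
    new bit 0 means a_k = 1, which leaves weight c_k + 1 if k < m and c_k > 0 if k > m. *)
Lemma flipwt_spec i : (1 <= i <= n)%N ->
  (flipwt W i)%:Z <= height (flip W) i /\
  (~~ flipNE W i -> (0 < flipwt W i)%N).
Proof.
move=> le_i; rewrite height_flip // /flipNE /flipwt.
have [h_end cle] := sr_laguerreP lagW; have [le_m c_m c_gt] := csP.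
set k := (n.+1 - i)%N; have le_k : (1 <= k <= n)%N by rewrite /k; lia.
have [le_ch c_gt0] := cle k le_k; have := c_gt k.
case: (ltngtP k (cs W)) => [lt_k|gt_k|eq_k] /= => [_|/(_ _) c_k|_].
- by case: (isNE _) le_ch c_gt0 => //=; lia.
- by case: (isNE _) le_ch c_gt0 => //=; lia.
- by rewrite eq_k isNE_cs // in le_ch *; split=> //; rewrite c_m in le_ch; lia.
Qed.

Lemma wwt_flip i : (1 <= i <= n)%N -> wwt (flip W) i = flipwt W i.
Proof.
move=> le_i; rewrite wwt_flip_inord // inordK //.
have [le_ch _] := flipwt_spec le_i.
have := @height_le n (flip W) i; lia.
Qed.

Lemma sr_laguerre_flip : sr_laguerre (flip W).
Proof.
apply/sr_laguerreP; split=> [|i le_i]; first exact: height_flip_end.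
by rewrite wwt_flip // wstep_flip // isNE_mkstep; apply: flipwt_spec.
Qed.

(** Later positions reflect k < m, where c_k + a_k > 0 because c_k = 0 forces a_k = 1. *)
Lemma cs_flip : cs (flip W) = (n.+1 - cs W)%N.
Proof.
have [_ cle] := sr_laguerreP lagW.
have [le_m c_m c_gt] := csP; apply: csE => [|| i lt_i]; first lia.
  rewrite wwt_flip /flipwt; last lia.
  by have -> : (n.+1 - (n.+1 - cs W) == cs W)%N by lia.
rewrite wwt_flip /flipwt; last lia.
have -> : (n.+1 - i == cs W)%N = false by lia.
have -> : (cs W < n.+1 - i)%N = false by lia.
have [] := cle (n.+1 - i)%N; first lia.
by case: (isNE _) => /=; lia.
Qed.

Let lagF := sr_laguerre_flip.

Lemma neb_flip : neb (flip W) = sdea W.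
Proof.
have [le_m _ _] := csP.
rewrite nebE // sdeaE // [RHS]big_nat_flip; apply: eq_big_nat => i lt_i.
rewrite cs_flip // wstep_flip // isNE_mkstep /flipNE isSdEN; congr nat_of_bool.
have -> : (i < n.+1 - cs W)%N = (cs W < n.+1 - i)%N by lia.
by case: ltngtP.
Qed.

Lemma sdeb_flip : sdeb (flip W) = nea W.
Proof.
have [le_m _ _] := csP.
rewrite sdebE // neaE // [RHS]big_nat_flip; apply: eq_big_nat => i lt_i.
rewrite cs_flip // wstep_flip // isSdEN isNE_mkstep /flipNE; congr nat_of_bool.
have -> : (i < n.+1 - cs W)%N = (cs W < n.+1 - i)%N by lia.
by rewrite negb_or negbK; case: ltngtP.
Qed.

Lemma nea_flip : nea (flip W) = sdeb W.
Proof.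
have [le_m _ _] := csP.
rewrite neaE // sdebE // [RHS]big_nat_flip; apply: eq_big_nat => i lt_i.
rewrite cs_flip // wstep_flip // isNE_mkstep /flipNE isSdEN; congr nat_of_bool.
have -> : (n.+1 - cs W < i)%N = (n.+1 - i < cs W)%N by lia.
by case: ltngtP.
Qed.

Lemma sdea_flip : sdea (flip W) = neb W.
Proof.
have [le_m _ _] := csP.
rewrite sdeaE // nebE // [RHS]big_nat_flip; apply: eq_big_nat => i lt_i.
rewrite cs_flip // wstep_flip // isSdEN isNE_mkstep /flipNE; congr nat_of_bool.
have -> : (n.+1 - cs W < i)%N = (n.+1 - i < cs W)%N by lia.
by rewrite negb_or negbK; case: ltngtP.
Qed.

Lemma nde_flip : (nde (flip W) + nde W = n.-1)%N.
Proof.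
apply: count_reflect => i lt_i; rewrite -!/(isNdE _).
by rewrite wstep_flip ?isNdE_mkstep /flipNdE; [case/andP: lt_i => _ ->|lia].
Qed.

Lemma asc_flip : (asc (flip W) + asc W = n.-1)%N.
Proof.
have [_ cle] := sr_laguerreP lagW; have [le_m c_m c_gt] := csP.
apply: count_reflect => i lt_i; rewrite !ascE.
rewrite !wwt_flip ?wstep_flip ?isNE_mkstep //; try lia.
rewrite /flipwt /flipNE subSS.
have -> : (n.+1 - i = (n - i).+1)%N by lia.
set k := (n - i)%N; have le_k : (1 <= k < n)%N by rewrite /k; lia.
have := c_gt k; have := c_gt k.+1.
have [_] := cle k ltac:(lia); have [_] := cle k.+1 ltac:(lia).
have NE_m := isNE_cs n_gt0 lagW.
(* Positions i and i + 1 reflect k + 1 and k. On one side of m, the flip ascends at i iff c_{k+1} +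
   1 <= c_k + a_k, which negates the condition at k. If k = m only W ascends; if k + 1 = m only the
   flip does. *)
case: (eqVneq k (cs W)) => [eq_m|ne_m];
  case: (eqVneq k.+1 (cs W)) => [eq_m1|ne_m1].
- lia.
- by rewrite eq_m NE_m c_m; case: isNE => /=; lia.
- by rewrite eq_m1 NE_m c_m; case: isNE => /=; lia.
by case: (ltnP k (cs W)) => ?; do 2!case: isNE => /=; lia.
Qed.

(** The height gains a_k for k < m and loses 1 - a_k for k > m. Adding [sdea W] on the left avoids
    truncated subtraction. *)
Lemma ht_flip : (ht (flip W) + sdea W = ht W + neb W)%N.
Proof.
have [_ cle] := sr_laguerreP lagW; have [le_m c_m c_gt] := csP.
rewrite /ht sdeaE // nebE // !(big_nat_flip (fun i => `|height W i|%N)).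
rewrite (big_nat_flip (fun i => (cs W < i) && _)%N).
rewrite (big_nat_flip (fun i => (i < cs W) && _)%N).
rewrite -!big_split /=; apply: eq_big_nat => i lt_i; rewrite height_flip //.
have NE_m := isNE_cs n_gt0 lagW; rewrite isSdEN.
set k := (n.+1 - i)%N; have le_k : (1 <= k <= n)%N by rewrite /k; lia.
have [] := cle k le_k; have := c_gt k.
case: (ltngtP k (cs W)) => [lt_k|gt_k|->] /=.
- by case: isNE => /=; lia.
- by case: isNE => /=; lia.
by rewrite NE_m /=; lia.
Qed.

Lemma wt_flip : (wt (flip W) + sdea W = wt W + neb W)%N.
Proof.
have [_ cle] := sr_laguerreP lagW; have [le_m c_m c_gt] := csP.
rewrite /wt sdeaE // nebE // !(big_nat_flip (wwt W)).
rewrite (big_nat_flip (fun i => (cs W < i) && _)%N).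
rewrite (big_nat_flip (fun i => (i < cs W) && _)%N).
rewrite -!big_split /=; apply: eq_big_nat => i lt_i; rewrite wwt_flip // /flipwt.
rewrite isSdEN.
set k := (n.+1 - i)%N; have le_k : (1 <= k <= n)%N by rewrite /k; lia.
have [] := cle k le_k; have := c_gt k.
case: (ltngtP k (cs W)) => [lt_k|gt_k|->] /=.
- by case: isNE => /=; lia.
- by case: isNE => /=; lia.
by rewrite c_m.
Qed.

End Statistics.

Lemma flipK W : (0 < n)%N -> sr_laguerre W -> flip (flip W) = W.
Proof.
move=> n_gt0 lagW; have [_ cle] := sr_laguerreP lagW.
have [le_m c_m c_gt] := cs_spec n_gt0 lagW.
apply: prehistory_eq => i le_i.
rewrite wstep_flip // wwt_flip ?sr_laguerre_flip //.
have lt_k : (1 <= n.+1 - i <= n)%N by lia.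
have kK : (n.+1 - (n.+1 - i) = i)%N by lia.
have eq_cs : (n.+1 - i == n.+1 - cs W)%N = (i == cs W) by lia.
have eqNE : flipNE (flip W) i = isNE (wstep W i).
  rewrite /flipNE cs_flip // wstep_flip // isNE_mkstep /flipNE kK eq_cs.
  by case: eqP => [->|_] /=; rewrite ?isNE_cs ?negbK.
have eqNdE : flipNdE (flip W) i = isNdE (wstep W i).
  rewrite /flipNdE; case: (ltnP i n) => [lt_in|ge_in] /=; last first.
    by rewrite (_ : i = n) ?isNdE_last //; lia.
  rewrite wstep_flip ?isNdE_mkstep /flipNdE; last lia.
  have -> : (n - (n - i) = i)%N by lia.
  by have -> : (n - i < n)%N by [lia]; rewrite negbK.
rewrite eqNE eqNdE mkstepK; split=> //.
rewrite /flipwt cs_flip // eq_cs wstep_flip // wwt_flip // isNE_mkstep.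
rewrite /flipNE /flipwt kK; case: eqP => [->|/eqP ne_i] //=.
(* Off m, the two flips add a_i and 1 - a_i, and exactly one of them subtracts 1, so c_i returns. *)
have [_] := cle i le_i; have := c_gt i.
by case: (isNE _) => /= [_ _|? /(_ isT)]; lia.
Qed.

End Flip.

(** * The functional equation, coefficient by coefficient *)

Lemma srL_gf_symmetry (K : comUnitRingType) (t1 t2 t3 t4 r s x v w : K) :
  r \is a GRing.unit -> s \is a GRing.unit -> x \is a GRing.unit ->
  v \is a GRing.unit -> w \is a GRing.unit ->
  srL_gf t1 t2 t3 t4 r s x v w =1
  fps_scale (x / (r * s))
    (fps_dilate (r * s * x)
      (srL_gf t4 (t3 / (v * w)) (v * w * t2) t1 r^-1 s^-1 x^-1 v w)).
Proof.
move=> Ur Us Ux Uv Uw n; rewrite /fps_scale /fps_dilate /srL_gf.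
case: eqP => [_|/eqP]; first by rewrite !mulr0.
rewrite -lt0n => n_gt0; rewrite !mulr_sumr.
rewrite [RHS](reindex_onto (@flip n) (@flip n)) => [|W lagW]; last exact: flipK.
apply: eq_big => [W|W lagW].
  (* Conversely, W = [flip (flip W)] is a history as the flip of the history [flip W]. *)
  apply/idP/andP => [lagW|[lagF /eqP <-]]; last exact: sr_laguerre_flip.
  by rewrite flipK // sr_laguerre_flip.
have [le_m _ _] := cs_spec n_gt0 lagW.
rewrite neb_flip // sdeb_flip // nea_flip // sdea_flip // cs_flip //.
have := wt_flip n_gt0 lagW; have := ht_flip n_gt0 lagW.
have := asc_flip n_gt0 lagW; have := nde_flip n_gt0 lagW.
move: (sdeb W) (sdea W) (neb W) (nea W) (nde W) (asc W) (cs W) (ht W) (wt W) le_m.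
move: (nde _) (asc _) (ht _) (wt _).
move=> nde' asc' ht' wt' i1 i2 i3 i4 ir js ix iv iw le_ix eqr eqs eqv eqw.
have powV (u : K) a b c : u \is a GRing.unit -> (a + b = c)%N ->
    u ^+ a = u ^+ c * u^-1 ^+ b.
  by move=> Uu <-; rewrite exprVn exprD mulrK ?unitrX.
(* Here r^-1 comes from the prefactor and r^n from the dilation; likewise for s and x. *)
have Er : r ^+ ir = r^-1 * r ^+ n * r^-1 ^+ nde'.
  rewrite (@powV r ir nde' n.-1) //; last lia.
  by rewrite -{2}(prednK n_gt0) exprS mulKr.
have Es : s ^+ js = s^-1 * s ^+ n * s^-1 ^+ asc'.
  rewrite (@powV s js asc' n.-1) //; last lia.
  by rewrite -{2}(prednK n_gt0) exprS mulKr.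
have Ex : x ^+ ix = x * x ^+ n * x^-1 ^+ (n.+1 - ix).
  by rewrite -exprS; apply: powV => //; lia.
(* The exponents [i2] = [sdea W] and [i3] = [neb W] come from the arguments v w t2 and t3 / (v
   w). *)
have Ev : v ^+ iv = v ^+ ht' * v ^+ i2 * v^-1 ^+ i3.
  by rewrite -exprD; apply: powV => //; lia.
have Ew : w ^+ iw = w ^+ wt' * w ^+ i2 * w^-1 ^+ i3.
  by rewrite -exprD; apply: powV => //; lia.
rewrite Er Es Ex Ev Ew !invrM // !exprMn.
ring.
Qed.

Theorem corollary1p1 :
  let t1 : laurent int 9 := lvar int 0 in
  let t2 : laurent int 9 := lvar int 1 in
  let t3 : laurent int 9 := lvar int 2 in
  let t4 : laurent int 9 := lvar int 3 in
  let r : laurent int 9 := lvar int 4 in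
  let s : laurent int 9 := lvar int 5 in
  let x : laurent int 9 := lvar int 6 in
  let v : laurent int 9 := lvar int 7 in
  let w : laurent int 9 := lvar int 8 in
  srL_gf t1 t2 t3 t4 r s x v w =1
  fps_scale (x / (r * s))
    (fps_dilate (r * s * x)
      (srL_gf t4 (t3 / (v * w)) (v * w * t2) t1 r^-1 s^-1 x^-1 v w)).
Proof. by move=> t1 t2 t3 t4 r s x v w; apply: srL_gf_symmetry; apply: lvar_unit. Qed.
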